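(* Let $g$ satisfy (G1) and (G2), let $\beta:=\max_{\pi\in[0,1]}|(\mathcal{A}g)(\pi)|$, and consider $A^*(K),B^*(K)$ for $K\in(\beta^{-1},\infty)$. Then: (i) $K\mapsto A^*(K)$ is decreasing and $K\mapsto B^*(K)$ is increasing. (ii) If $K\uparrow\infty$ then $A^*(K)\downarrow0$ and $B^*(K)\uparrow1$. (iii) If $K\downarrow\beta^{-1}$ then $A^*(K)\uparrow\pi_0$ and $B^*(K)\downarrow\pi_0$, where $\pi_0$ is the point in (G2).
   Context: For $f\in C^2(0,1)$, $(\mathcal{A}f)(\pi):=\tfrac12\pi^2(1-\pi)^2f''(\pi)$. The function $g:[0,1]\to\mathbb{R}$ satisfies: (G1) $g\in C^2(0,1)$ is concave and $g(0)=g(1)=0$; (G2) there exists $\pi_0\in(0,1)$ such that $\mathcal{A}g$ is strictly decreasing on $(0,\pi_0)$ and strictly increasing on $(\pi_0,1)$. The limits of $\mathcal{A}g$ at $0$ and $1$ are $0$, so $\mathcal{A}g$ is extended by $0$ to $\{0,1\}$, and $\beta=|(\mathcal{A}g)(\pi_0)|>0$. The function $g$ is fixed and $K$ is a positive parameter. For $\pi\in(0,1)$, $\Psi(\pi):=(1-2\pi)\log\left(\frac{\pi}{1-\pi}\right)$ and $H(\pi;K):=g(\pi)-2K^{-1}\Psi(\pi)$; $H'$ denotes the derivative in $\pi$. For $K>\beta^{-1}$ the set $\{\pi\in(0,1):(\mathcal{A}g)(\pi)<-K^{-1}\}$ is a nonempty open interval with endpoints $0<\pi_*(K)<\pi^*(K)<1$,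 and $(A^*(K),B^*(K))$ denotes the unique pair $(A,B)\in(0,1)^2$ with $A\le\pi_*(K)$, $B\ge\pi^*(K)$, satisfying $H(B;K)-H(A;K)=H'(A;K)(B-A)$ and $H'(A;K)=H'(B;K)$. *)

(* Defs.v *)
From HB Require Import structures.
From mathcomp Require Import all_boot all_order all_algebra.
From mathcomp Require Import all_classical all_reals all_analysis.
Import Order.TTheory GRing.Theory Num.Theory.
Import numFieldNormedType.Exports.

Set Implicit Arguments.
Unset Strict Implicit.
Unset Printing Implicit Defensive.

Local Open Scope classical_set_scope.
Local Open Scope ring_scope.

(* A function on [0, 1] is represented by a total function R -> R whose values
   outside [0, 1] play no role below. *)

Definition C2_on01 (R : realType) (f : R -> R) : Prop :=
  forall x : R, x \in `]0, 1[ ->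
    [/\ derivable f x 1, derivable f^`()%classic x 1 & {for x, continuous f^`(2)%classic}].

(* The factor vanishes at 0 and 1, so this total function is already the
   extension by 0 to the endpoints, whatever f^`(2) is there. *)
Definition calA (R : realType) (f : R -> R) (x : R) : R :=
  2^-1 * x ^+ 2 * (1 - x) ^+ 2 * f^`(2)%classic x.

Definition G1 (R : realType) (g : R -> R) : Prop :=
  [/\ C2_on01 g,
      forall x y t : R, x \in `[0, 1] -> y \in `[0, 1] -> t \in `[0, 1] ->
        t * g x + (1 - t) * g y <= g (t * x + (1 - t) * y),
      g 0 = 0
    & g 1 = 0].

(* p0 is a parameter, since the minimum point is referred to by name; it is
   unique. *)
Definition G2 (R : realType) (g : R -> R) (p0 : R) : Prop :=
  [/\ p0 \in `]0, 1[,
      {in `]0, p0[ &, {homo calA g : x y /~ x < y}}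
    & {in `]p0, 1[ &, {homo calA g : x y / x < y}}].

(* Under (G1) and (G2) this supremum is a maximum, attained at p0. *)
Definition beta (R : realType) (g : R -> R) : R :=
  sup [set `|calA g x| | x in `[0, 1] ].

Definition Psi (R : realType) (x : R) : R := (1 - 2 * x) * ln (x / (1 - x)).

Definition H (R : realType) (g : R -> R) (K x : R) : R :=
  g x - 2 * K^-1 * Psi x.

Definition below_set (R : realType) (g : R -> R) (K : R) : set R :=
  [set x | x \in (`]0, 1[) /\ calA g x < - K^-1].

(* For K > beta^-1, below_set g K is a nonempty open interval, and these are its
   endpoints. *)
Definition pi_lo (R : realType) (g : R -> R) (K : R) : R := inf (below_set g K).
Definition pi_up (R : realType) (g : R -> R) (K : R) : R := sup (below_set g K).

Definition tangency_pair (R : realType) (g : R -> R) (K : R) : set (R * R) :=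
  [set AB | let: (A, B) := AB in
    [/\ (A \in `]0, 1[) && (B \in `]0, 1[),
        A <= pi_lo g K,
        pi_up g K <= B,
        H g K B - H g K A = (H g K)^`()%classic A * (B - A)
      & (H g K)^`()%classic A = (H g K)^`()%classic B]].

(* xget selects an element of tangency_pair g K, which is a singleton for
   K > beta^-1; the default (0, 0) is not a tangency pair. *)
Definition AB_star (R : realType) (g : R -> R) (K : R) : R * R :=
  xget (0, 0) (tangency_pair g K).

Definition A_star (R : realType) (g : R -> R) (K : R) : R := (AB_star g K).1.
Definition B_star (R : realType) (g : R -> R) (K : R) : R := (AB_star g K).2.

(* Main.v *)
(* With [e = K^-1], the second derivative of [H g K] has the sign of
   [calA g + e], so [H g K] is convex, then concave, then convex, and the line
   through a tangency pair [(A, B)] stays below the graph. As [e] increases, a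
   positive multiple of the strictly convex function [- Psi] is added, which
   forces the tangency interval to shrink strictly.

   Existence of the pair: for each admissible slope [s], minimise [H - s x] over
   the left and over the right convex part; the two minima are 1-Lipschitz in
   [s], and their difference changes sign.

   As [K] tends to infinity, every point of [(0, 1)] eventually lies in
   [below_set g K], hence between [A_star g K] and [B_star g K]. As [K] tends to
   [(beta g)^-1], the slope of [H] tends to a strictly increasing function,
   uniformly on a compact interval containing all the tangency points, so equal
   slopes at the two points force them together. *)

Require Import Defs.
From HB Require Import structures.
From mathcomp Require Import all_boot all_order all_algebra.
From mathcomp Require Import all_classical all_reals all_analysis.
From mathcomp Require Import ring lra.
Import Order.TTheory GRing.Theory Num.Theory.
Import numFieldNormedType.Exports.

Local Open Scope classical_set_scope.
Local Open Scope ring_scope.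

(** * Mean value theorem, tangent lines and Lipschitz continuity *)

Lemma is_derive_continuous {R : realType} {f : R -> R} {x d : R} :
  is_derive x 1 f d -> {for x, continuous f}.
Proof.
by move=> fd; apply/differentiable_continuous/derivable1_diffP; exact: ex_derive.
Qed.

Lemma within_continuous_itvcc {R : realType} {f : R -> R} {a b : R} :
  (forall x : R, a <= x <= b -> {for x, continuous f}) ->
  {within `[a, b], continuous f}.
Proof.
move=> fc; apply: continuous_in_subspaceT => x /set_mem /=.
by rewrite in_itv; exact: fc.
Qed.

Lemma mean_value {R : realType} {f df : R -> R} {a b : R} : a < b ->
  (forall x : R, a <= x <= b -> is_derive x 1 f (df x)) ->
  exists2 c, a < c < b & f b - f a = df c * (b - a).
Proof.
move=> ab fd; have [x /[!in_itv] xab||c] := @MVT R f df a b ab.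
- by apply: fd; case/andP: xab => /ltW -> /ltW ->.
- by apply: within_continuous_itvcc => x /fd /is_derive_continuous.
- by rewrite in_itv; exists c.
Qed.

Lemma pos_derive_lt {R : realType} {f df : R -> R} {a b : R} : a < b ->
  (forall x : R, a <= x <= b -> is_derive x 1 f (df x)) ->
  (forall x, a < x < b -> 0 < df x) -> f a < f b.
Proof.
move=> ab fd fpos; have [c cab fE] := mean_value ab fd.
by rewrite -subr_gt0 fE mulr_gt0 ?fpos// subr_gt0.
Qed.

Lemma neg_derive_gt {R : realType} {f df : R -> R} {a b : R} : a < b ->
  (forall x : R, a <= x <= b -> is_derive x 1 f (df x)) ->
  (forall x, a < x < b -> df x < 0) -> f b < f a.
Proof.
move=> ab fd fneg; have [c cab fE] := mean_value ab fd.
by rewrite -subr_lt0 fE nmulr_rlt0 ?fneg// subr_gt0.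
Qed.

(** The chord over [[a, x]] has slope [h c] with [c] strictly inside. Comparing slopes with [h a]
    alone, instead of asking [h] to be monotone, lets a tangent be followed across an inflection
    point. *)
Lemma tangent_lt_right {R : realType} {F h : R -> R} {a x : R} : a < x ->
  (forall y, a <= y <= x -> is_derive y 1 F (h y)) ->
  (forall y, a < y < x -> h a < h y) -> F a + h a * (x - a) < F x.
Proof.
move=> ax Fd hinc; have [c cax FE] := mean_value ax Fd.
by rewrite addrC -ltrBrDr FE ltr_pM2r ?subr_gt0// hinc.
Qed.

Lemma tangent_lt_left {R : realType} {F h : R -> R} {a x : R} : x < a ->
  (forall y, x <= y <= a -> is_derive y 1 F (h y)) ->
  (forall y, x < y < a -> h y < h a) -> F a + h a * (x - a) < F x.
Proof.
move=> xa Fd hinc; have [c cxa FE] := mean_value xa Fd.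
have : h c * (a - x) < h a * (a - x) by rewrite ltr_pM2r ?subr_gt0// hinc.
lra.
Qed.

Lemma lipschitz_within_continuous {R : realType} {f : R -> R} {k : R} {A : set R} :
  (forall x y, A x -> A y -> `|f x - f y| <= k * `|x - y|) ->
  {within A, continuous f}.
Proof.
move=> fk; apply/subspace_continuousP => x Ax.
apply/cvgrPdist_lt => e e0; near=> y.
have Ay : A y by near: y; exact: withinT.
apply: (le_lt_trans (fk _ _ Ax Ay)).
have k0 : 0 < `|k| + 1 by rewrite ltr_wpDl.
apply: (@le_lt_trans _ _ ((`|k| + 1) * `|x - y|)).
  by rewrite ler_wpM2r//; have := ler_norm k; lra.
rewrite -ltr_pdivlMl// mulrC.
near: y; apply: cvg_within; apply: nbhsx_ballx; first by rewrite divr_gt0.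
Unshelve. all: by end_near. Qed.

(** * Common tangents of convex-concave-convex functions *)

Definition convex_concave_convex {R : realType} (F h : R -> R) (p q : R) : Prop :=
  [/\ (forall x : R, 0 < x < 1 -> is_derive x 1 F (h x)),
      (forall x y : R, 0 < x -> x < y -> y <= p -> h x < h y),
      (forall x y : R, p <= x -> x < y -> y <= q -> h y < h x)
    & (forall x y : R, q <= x -> x < y -> y < 1 -> h x < h y)].

Definition bitangent {R : realType} (F h : R -> R) (A B : R) : Prop :=
  F B - F A = h A * (B - A) /\ h A = h B.

(** On each outer part the line is the tangent of a convex piece, at [A] or at [B]. In the middle,
    [F] lies above its chord from [p] to [q], whose ends are already on or above the line. *)
Lemma bitangent_below {R : realType} {F h : R -> R} {p q A B x : R} :
  0 < p -> p < q -> q < 1 -> convex_concave_convex F h p q ->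
  0 < A <= p -> q <= B < 1 -> bitangent F h A B ->
  0 < x < 1 -> F A + h A * (x - A) <= F x.
Proof.
move=> p0 pq q1 [Fd hl hm hr] /andP[A0 Ap] /andP[qB B1] [FAB hAB].
have Fd' (u v y : R) : 0 < u -> v < 1 -> u <= y <= v -> is_derive y 1 F (h y).
  by move=> u0 v1 /andP[uy yv]; apply: Fd; lra.
have left y : 0 < y -> y <= p -> F A + h A * (y - A) <= F y.
  move=> y0 yp; case: (ltgtP y A) => [yA|Ay|->]; last lra.
    apply/ltW/tangent_lt_left => //; first by move=> z; apply: Fd'; lra.
    by move=> z /andP[*]; apply: hl; lra.
  apply/ltW/tangent_lt_right => //; first by move=> z; apply: Fd'; lra.
  by move=> z /andP[*]; apply: hl; lra.
have lineE y : F A + h A * (y - A) = F B + h B * (y - B) by rewrite -hAB; lra.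
have right y : q <= y -> y < 1 -> F A + h A * (y - A) <= F y.
  move=> qy y1; rewrite lineE; case: (ltgtP y B) => [yB|By|->]; last lra.
    apply/ltW/tangent_lt_left => //; first by move=> z; apply: Fd'; lra.
    by move=> z /andP[*]; apply: hr; lra.
  apply/ltW/tangent_lt_right => //; first by move=> z; apply: Fd'; lra.
  by move=> z /andP[*]; apply: hr; lra.
move=> /andP[x0 x1]; have [xp|px] := leP x p; first exact: left.
have [qx|xq] := leP q x; first exact: right.
have [|c /andP[pc cx] Fc] := @mean_value _ F h _ _ px.
  by move=> z; apply: Fd'; lra.
have [|d /andP[xd dq] Fq] := @mean_value _ F h _ _ xq.
  by move=> z; apply: Fd'; lra.
have hcd : h d < h c by apply: hm; lra.
have Lp := left p p0 (lexx _); have Rq := right q (lexx _) q1.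
have qp : 0 < q - p by lra.
have cd : 0 < (h c - h d) * ((q - x) * (x - p)).
  by rewrite mulr_gt0 ?mulr_gt0 //; lra.
have Lpm : 0 <= (q - x) * (F p - (F A + h A * (p - A))) by rewrite mulr_ge0 //; lra.
have Rqm : 0 <= (x - p) * (F q - (F A + h A * (q - A))) by rewrite mulr_ge0 //; lra.
(* After multiplication by [q - p], [x] is a weighted mean of [p] and [q]; the last summand below is
   the concavity gap, equal to [(h c - h d) * ((q - x) * (x - p))]. *)
rewrite -(ler_pM2l qp) -subr_ge0.
have -> : (q - p) * F x - (q - p) * (F A + h A * (x - A)) =
  (q - x) * (F p - (F A + h A * (p - A))) + (x - p) * (F q - (F A + h A * (q - A)))
  + ((q - x) * (F x - F p) - (x - p) * (F q - F x)) by ring.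
rewrite Fc Fq; lra.
Qed.

(** If [h] exceeded [s] on all of []0, p[], the mean value theorem would bound [F] there by [F p]
    plus the absolute value of [s]. *)
Lemma slope_le_left {R : realType} {F h : R -> R} {p s : R} : 0 < p < 1 ->
  (forall x : R, 0 < x < 1 -> is_derive x 1 F (h x)) ->
  (forall M, exists2 x, 0 < x < p & M < F x) ->
  exists2 x, 0 < x < p & h x <= s.
Proof.
move=> /andP[p0 p1] Fd Finf; apply: contrapT => nex.
have hs x : 0 < x < p -> s < h x.
  by move=> xp; rewrite ltNge; apply/negP => ?; apply: nex; exists x.
have [x /andP[x0 xp] Fx] := Finf (F p + `|s|).
have [|c /andP[xc cp] Fc] := @mean_value _ F h _ _ xp.
  by move=> z ?; apply: Fd; lra.
have sc : s * (p - x) < h c * (p - x).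
  by rewrite ltr_pM2r ?hs //; lra.
have : - `|s| * (p - x) <= s * (p - x).
  by rewrite ler_pM2r ?subr_gt0// lerNl -normrN ler_norm.
have : `|s| * (p - x) <= `|s| * 1 by rewrite ler_wpM2l//; lra.
lra.
Qed.

Lemma slope_ge_right {R : realType} {F h : R -> R} {q s : R} : 0 < q < 1 ->
  (forall x : R, 0 < x < 1 -> is_derive x 1 F (h x)) ->
  (forall M, exists2 x, q < x < 1 & M < F x) ->
  exists2 x, q < x < 1 & s <= h x.
Proof.
move=> /andP[q0 q1] Fd Finf; apply: contrapT => nex.
have hs x : q < x < 1 -> h x < s.
  by move=> xp; rewrite ltNge; apply/negP => ?; apply: nex; exists x.
have [x /andP[qx x1] Fx] := Finf (F q + `|s|).
have [|c /andP[xc cp] Fc] := @mean_value _ F h _ _ qx.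
  by move=> z ?; apply: Fd; lra.
have sc : h c * (x - q) < s * (x - q).
  by rewrite ltr_pM2r ?hs //; lra.
have : s * (x - q) <= `|s| * (x - q).
  by rewrite ler_pM2r ?subr_gt0// ler_norm.
have : `|s| * (x - q) <= `|s| * 1 by rewrite ler_wpM2l//; lra.
lra.
Qed.

Lemma bitangent_exists {R : realType} {F h : R -> R} {p q : R} :
  0 < p -> p < q -> q < 1 -> convex_concave_convex F h p q ->
  (forall x : R, 0 < x < 1 -> {for x, continuous h}) ->
  (forall M, exists2 x, 0 < x < p & M < F x) ->
  (forall M, exists2 x, q < x < 1 & M < F x) ->
  exists A B, [/\ 0 < A <= p, q <= B < 1 & bitangent F h A B].
Proof.
move=> p0 pq q1 [Fd hl hm hr] hc Fl Fr.
have hqp : h q < h p by apply: hm.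
(* Blow-up at both ends makes [h] fall to [h q] or below on the left and rise to [h p] or above on
   the right, so every slope in [[h q, h p]] is attained on both convex parts. *)
have [x /andP[x0 xp] hx] : exists2 x, 0 < x < p & h x <= h q.
  by apply: slope_le_left Fl => //; lra.
have [y /andP[qy y1] hy] : exists2 y, q < y < 1 & h p <= h y.
  by apply: slope_ge_right Fr => //; lra.
(* [A s] is the contact point of slope [s] on the left part; the value [0] is a dummy for the other
   slopes. *)
have /choice[A hA] : forall s : R, exists a, h q <= s <= h p -> 0 < a <= p /\ h a = s.
  move=> s.
  case: (boolP (h q <= s <= h p)) => [/andP[s1 s2]|_]; last by exists 0.
  have [||a] := @IVT _ h x p s (ltW xp).
  - by apply: within_continuous_itvcc => z ?; apply: hc; lra.
  - by rewrite ge_min le_max (le_trans hx s1) s2 orbT.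
  - by rewrite in_itv /= => /andP[? ?] ?; exists a => _; split=> //; lra.
have /choice[B hB] : forall s : R, exists b, h q <= s <= h p -> q <= b < 1 /\ h b = s.
  move=> s.
  case: (boolP (h q <= s <= h p)) => [/andP[s1 s2]|_]; last by exists 0.
  have [||b] := @IVT _ h q y s (ltW qy).
  - by apply: within_continuous_itvcc => z ?; apply: hc; lra.
  - by rewrite ge_min le_max (le_trans s2 hy) s1 orbT.
  - by rewrite in_itv /= => /andP[? ?] ?; exists b => _; split=> //; lra.
have minA s z : h q <= s <= h p -> 0 < z <= p -> F (A s) - s * A s <= F z - s * z.
  move=> /hA[/andP[? ?] hs] /andP[? ?].
  have : F (A s) + h (A s) * (z - A s) <= F z.
    case: (ltgtP z (A s)) => [zA|Az|->]; last lra.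
      apply/ltW/tangent_lt_left => // w /andP[*]; first by apply: Fd; lra.
      by apply: hl; lra.
    apply/ltW/tangent_lt_right => // w /andP[*]; first by apply: Fd; lra.
    by apply: hl; lra.
  rewrite hs; lra.
have minB s z : h q <= s <= h p -> q <= z < 1 -> F (B s) - s * B s <= F z - s * z.
  move=> /hB[/andP[? ?] hs] /andP[? ?].
  have : F (B s) + h (B s) * (z - B s) <= F z.
    case: (ltgtP z (B s)) => [zB|Bz|->]; last lra.
      apply/ltW/tangent_lt_left => // w /andP[*]; first by apply: Fd; lra.
      by apply: hr; lra.
    apply/ltW/tangent_lt_right => // w /andP[*]; first by apply: Fd; lra.
    by apply: hr; lra.
  rewrite hs; lra.
(* At a zero of [W] the tangents of slope [s] at [A s] and at [B s] have the same intercept, hence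
   coincide. *)
pose W s := (F (A s) - s * A s) - (F (B s) - s * B s).
have Wlip s t : h q <= s <= h p -> h q <= t <= h p -> W s - W t <= 2 * `|s - t|.
  move=> hs ht; have [As _] := hA _ hs; have [At _] := hA _ ht.
  have [Bs _] := hB _ hs; have [Bt _] := hB _ ht.
  have := minA s _ hs At; have := minB t _ ht Bs; rewrite /W.
  (* The contact points lie in []0, 1[], so passing from [t] to [s] moves each minimum by at most
     the distance of the slopes; two minima give the constant 2. *)
  have Hn z : 0 < z < 1 -> (t - s) * z <= `|s - t|.
    move=> /andP[z0 z1]; apply: (@le_trans _ _ (`|s - t| * z)).
      by rewrite ler_pM2r// distrC ler_norm.
    by rewrite ler_piMr// ltW.
  have Hn' z : 0 < z < 1 -> (s - t) * z <= `|s - t|.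
    move=> /andP[z0 z1]; apply: (@le_trans _ _ (`|s - t| * z)).
      by rewrite ler_pM2r// ler_norm.
    by rewrite ler_piMr// ltW.
  have := Hn (A t); have := Hn' (B s); lra.
have [||s] := @IVT _ W (h q) (h p) 0 (ltW hqp).
- apply: (@lipschitz_within_continuous _ _ 2) => s t /=.
  rewrite !in_itv /= => hs ht; rewrite ler_norml.
  have := Wlip _ _ hs ht; have := Wlip _ _ ht hs; rewrite (distrC t); lra.
- have hqm : h q <= h q <= h p by lra.
  have hpm : h q <= h p <= h p by lra.
  (* At the lowest slope the right contact point is [q] itself, and the tangent at [A (h q)] passes
     strictly below [F q], since [h] exceeds [h q] in between. At the slope [h p] the two sides
     exchange roles. *)
  have Wq : W (h q) < 0.
    have : F q - h q * q <= F (B (h q)) - h q * B (h q).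
      have [/andP[qB B1]] := hB _ hqm;
        case: (ltgtP q (B (h q))) qB => // [qB' _|<- _ _]; last by lra.
      by move=> hE; have := hr _ _ (lexx q) qB' B1; rewrite hE; lra.
    have [/andP[A0 Ap] hE] := hA _ hqm.
    have Aq : A (h q) < q by lra.
    rewrite /W; set a := A _ in A0 Ap hE Aq *.
    suff : F a + h a * (q - a) < F q by rewrite hE; lra.
    apply: tangent_lt_right => // z /andP[*]; first by apply: Fd; lra.
    have [zp|pz] := leP z p; first by apply: hl; lra.
    by rewrite hE; apply: hm; lra.
  have Wp : 0 < W (h p).
    have : F p - h p * p <= F (A (h p)) - h p * A (h p).
      have [/andP[A0 Ap]] := hA _ hpm;
        case: (ltgtP p (A (h p))) Ap => // [Ap' _|<- _ _]; last by lra.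
      by move=> hE; have := hl _ _ A0 Ap' (lexx p); rewrite hE; lra.
    have [/andP[qB B1] hE] := hB _ hpm.
    have pB : p < B (h p) by lra.
    rewrite /W; set b := B _ in qB B1 hE pB *.
    suff : F b + h b * (p - b) < F p by rewrite hE; lra.
    apply: tangent_lt_left => // z /andP[*]; first by apply: Fd; lra.
    have [qz|zq] := leP q z; first by apply: hr; lra.
    by rewrite hE; apply: hm; lra.
  by rewrite ge_min le_max (ltW Wq) (ltW Wp) orbT.
rewrite in_itv /= /W => hs Ws.
have [As hAs] := hA _ hs; have [Bs hBs] := hB _ hs.
by exists (A s), (B s); split=> //; split; rewrite hAs ?hBs//; lra.
Qed.

(* If the interval of [F1] were not strictly inside that of [F], then [d * phi],
   which is the difference of the two functions, would violate strict convexity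
   at the contact points of [F] and [F1]. *)
Lemma bitangent_lt {R : realType} {F h F1 h1 phi dphi : R -> R} {d p q p1 q1 c A B A1 B1 : R} :
  (forall x, F1 x = F x + d * phi x) -> (forall x, h1 x = h x + d * dphi x) ->
  0 < d ->
  (forall x : R, 0 < x < 1 -> is_derive x 1 phi (dphi x)) ->
  (forall x y : R, 0 < x -> x < y -> y < 1 -> dphi x < dphi y) ->
  0 < p < c -> c < q < 1 -> convex_concave_convex F h p q ->
  0 < p1 < c -> c < q1 < 1 -> convex_concave_convex F1 h1 p1 q1 ->
  0 < A <= p -> q <= B < 1 -> bitangent F h A B ->
  0 < A1 <= p1 -> q1 <= B1 < 1 -> bitangent F1 h1 A1 B1 ->
  A < A1 /\ B1 < B.
Proof.
move=> dF dh d0 phid dphi_lt /andP[p0 pc] /andP[cq q1' ] cF /andP[p10 pc1]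
  /andP[cq1 q11] cF1 hA hB bF hA1 hB1 bF1.
have below x : 0 < x < 1 -> F A + h A * (x - A) <= F x.
  by apply: (bitangent_below p0 _ _ cF hA hB bF); lra.
have below1 x : 0 < x < 1 -> F1 A1 + h1 A1 * (x - A1) <= F1 x.
  by apply: (bitangent_below p10 _ _ cF1 hA1 hB1 bF1); lra.
have phi_lt a x : 0 < a < 1 -> 0 < x < 1 -> a != x ->
    phi a + dphi a * (x - a) < phi x.
  move=> /andP[? ?] /andP[? ?]; case: (ltgtP a x) => // ax _.
    apply: tangent_lt_right => // z /andP[*]; first by apply: phid; lra.
    by apply: dphi_lt; lra.
  apply: tangent_lt_left => // z /andP[*]; first by apply: phid; lra.
  by apply: dphi_lt; lra.
(* Strict convexity of [d * phi] without division: in the tangent inequalities at [x], weighted by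
   [b - x] and [x - a], the slope terms cancel. *)
have phi_chord a x b : 0 < a -> a < x -> x < b -> b < 1 ->
    d * phi x * (b - a) < (d * phi a) * (b - x) + (d * phi b) * (x - a).
  move=> a0 ax xb b1.
  have := phi_lt x a; have := phi_lt x b; rewrite !neq_lt ax xb orbT /=.
  have Hx : 0 < x < 1 by lra.
  have Ha : 0 < a < 1 by lra.
  have Hb : 0 < b < 1 by lra.
  move=> /(_ Hx Hb isT) pb /(_ Hx Ha isT) pa.
  have da : 0 < d * (b - x) by rewrite mulr_gt0// subr_gt0.
  have db : 0 < d * (x - a) by rewrite mulr_gt0// subr_gt0.
  rewrite -(ltr_pM2l da) in pa; rewrite -(ltr_pM2l db) in pb; lra.
have [F1E h1E] : (F1 B1 = F1 A1 + h1 A1 * (B1 - A1)) /\ h1 A1 = h1 B1.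
  by case: bF1; split=> //; lra.
have [FE hE] : (F B = F A + h A * (B - A)) /\ h A = h B.
  by case: bF; split=> //; lra.
have A01 : 0 < A < 1 by lra.
have B01 : 0 < B < 1 by lra.
have A101 : 0 < A1 < 1 by lra.
have B101 : 0 < B1 < 1 by lra.
have lA1 := below _ A101; have lB1 := below _ B101.
have lA := below1 _ A01; have lB := below1 _ B01.
rewrite !dF !dh in F1E h1E lA lB.
split; rewrite ltNge; apply/negP => le.
- have AB1 : A < B1 by lra.
  (* If [A1 = A], subtracting the two lines puts [d * phi] at [B1] on or below its own tangent at
     [A]. *)
  move: le; rewrite le_eqVlt => /predU1P[A1A|A1A].
    have : d * (phi A + dphi A * (B1 - A)) < d * phi B1.
      by rewrite ltr_pM2l// phi_lt// neq_lt AB1.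
    move: F1E lB1; rewrite A1A; lra.
  (* Here [F1] meets its line at [A1] and [B1] and is not below it at [A], while [F] meets its line
     at [A] and is not below it at [A1] and [B1]. So the difference [d * phi] at [A] is at least its
     chord value, against strict convexity. *)
  have := phi_chord A1 A B1.
  have : (F A + h A * (A1 - A)) * (B1 - A) <= F A1 * (B1 - A) by rewrite ler_pM2r //; lra.
  have : (F A + h A * (B1 - A)) * (A - A1) <= F B1 * (A - A1) by rewrite ler_pM2r //; lra.
  have BA1 : 0 < B1 - A1 by lra.
  rewrite -(ler_pM2r BA1) in lA.
  have : (F B1 + d * phi B1) * (A - A1) =
    (F A1 + d * phi A1 + (h A1 + d * dphi A1) * (B1 - A1)) * (A - A1) by rewrite F1E.
  lra.
- have BA1 : A1 < B by lra.
  move: le; rewrite le_eqVlt => /predU1P[BB1|BB1].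
    have : d * (phi B + dphi B * (A1 - B)) < d * phi A1.
      by rewrite ltr_pM2l// phi_lt// neq_lt BA1 orbT.
    move: F1E lA1; rewrite h1E -BB1 -hE; lra.
  have := phi_chord A1 B B1.
  have : (F A + h A * (A1 - A)) * (B1 - B) <= F A1 * (B1 - B) by rewrite ler_pM2r //; lra.
  have : (F A + h A * (B1 - A)) * (B - A1) <= F B1 * (B - A1) by rewrite ler_pM2r //; lra.
  have BA : 0 < B1 - A1 by lra.
  rewrite -(ler_pM2r BA) in lB.
  have : (F B1 + d * phi B1) * (B - A1) =
    (F A1 + d * phi A1 + (h A1 + d * dphi A1) * (B1 - A1)) * (B - A1) by rewrite F1E.
  have : F B * (B1 - A1) = (F A + h A * (B - A)) * (B1 - A1) by rewrite FE.
  lra.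
Qed.

(** * The function [Psi]: derivatives, symmetry and blow-up *)

Definition dPsi {R : realType} (x : R) : R :=
  (1 - 2 * x) / (x * (1 - x)) - 2 * ln (x / (1 - x)).

Lemma is_derive_logit {R : realType} {x : R} : 0 < x < 1 ->
  is_derive x 1 (fun y => ln (y / (1 - y)) : R) (x * (1 - x))^-1.
Proof.
move=> /andP[x0 x1]; have y0 : 1 - x != 0 by rewrite subr_eq0 gt_eqF.
have x0' : x != 0 by rewrite gt_eqF.
have d1 : is_derive x 1 (fun y : R => 1 - y) (- 1).
  by apply: (is_derive_eq (is_deriveB _ _)); lra.
have d2 := @is_deriveV R (fun y => 1 - y) x _ 1 y0 d1.
have d3 : is_derive x 1 (fun y : R => y / (1 - y)) ((1 - x) ^- 2).
  apply: (is_derive_eq (is_deriveM (is_derive_id _ _) d2)).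
  by rewrite /GRing.scale /=; field.
have yx : 0 < x / (1 - x) by rewrite divr_gt0// subr_gt0.
apply: (is_derive_eq (@is_derive1_comp R _ (fun y => y / (1 - y)) _ _ _ (is_derive1_ln yx) d3)).
by field; rewrite x0' y0.
Qed.

Lemma is_derive_Psi {R : realType} {x : R} : 0 < x < 1 ->
  is_derive x 1 (@Psi R) (dPsi x).
Proof.
move=> x01; have d1 : is_derive x 1 (fun y : R => 1 - 2 * y) (- 2).
  apply: (is_derive_eq (is_deriveB _ _)).
  by rewrite /GRing.scale /=; lra.
apply: (is_derive_eq (is_deriveM d1 (is_derive_logit x01))).
rewrite /dPsi /GRing.scale /=; lra.
Qed.

(** This amounts to [calA Psi = - 2^-1] on []0, 1[], so that subtracting [2 * K^-1 * Psi] from [g]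
    adds exactly [K^-1] to [calA g]. *)
Lemma is_derive_dPsi {R : realType} {x : R} : 0 < x < 1 ->
  is_derive x 1 (@dPsi R) (- (x * (1 - x)) ^- 2).
Proof.
move=> x01; case/andP: (x01) => x0 x1.
have y0 : 1 - x != 0 by rewrite subr_eq0 gt_eqF.
have x0' : x != 0 by rewrite gt_eqF.
have d1 : is_derive x 1 (fun y : R => 1 - 2 * y) (- 2).
  apply: (is_derive_eq (is_deriveB _ _)).
  by rewrite /GRing.scale /=; lra.
have d0 : is_derive x 1 (fun y : R => 1 - y) (- 1).
  by apply: (is_derive_eq (is_deriveB _ _)); lra.
have d2 : is_derive x 1 (fun y : R => y * (1 - y)) (1 - 2 * x).
  apply: (is_derive_eq (is_deriveM (is_derive_id _ _) d0)).
  by rewrite /GRing.scale /=; lra.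
have xy0 : x * (1 - x) != 0 by rewrite mulf_neq0.
have d3 := is_deriveM d1 (@is_deriveV R (fun y => y * (1 - y)) x _ 1 xy0 d2).
have d4 := is_deriveZ 2 (is_derive_logit x01).
apply: (is_derive_eq (is_deriveB d3 d4)).
by rewrite /GRing.scale /=; field; rewrite x0' y0.
Qed.

(** Both factors of [Psi] change sign. The symmetry carries the blow-up at [0] over to [1]. *)
Lemma Psi1B {R : realType} {x : R} : 0 < x < 1 -> Psi (1 - x) = Psi x.
Proof.
move=> /andP[x0 x1]; have y0 : 0 < 1 - x by rewrite subr_gt0.
have -> : (Psi (1 - x) = (1 - 2 * (1 - x)) * ln ((x / (1 - x))^-1)).
  by rewrite /Psi subKr invf_div.
rewrite lnV ?posrE ?divr_gt0// /Psi; ring.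
Qed.

Lemma Psi_unbounded_below {R : realType} (M : R) {p : R} : 0 < p ->
  exists2 x, 0 < x < p /\ x < 1 & M < - Psi x.
Proof.
(* The bound [x <= 4^-1] keeps [1 - 2 * x] at least [1 / 2], and the exponential bound makes the
   logarithm at most [- N * 2]; hence [- Psi x >= N > M]. *)
move=> p0; pose N := `|M| + 1; pose x := Num.min (p / 2) (Num.min 4^-1 (expR (- N * 2) / 2)).
have N1 : 1 <= N by rewrite lerDr.
have eN := expR_gt0 (- N * 2).
have x0 : 0 < x by rewrite !lt_min; apply/and3P; split; lra.
have : x <= x by [].
rewrite {2}/x !le_min => /and3P[xp x4 xe].
exists x; first by lra.
apply: (@lt_le_trans _ _ N); first by rewrite (le_lt_trans (ler_norm _))// ltrDl.
have : ln (x / (1 - x)) <= - N * 2.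
  rewrite -[leRHS]expRK ler_ln ?posrE ?expR_gt0 ?divr_gt0//; last lra.
  rewrite ler_pdivrMr; last lra.
  have : 0 < expR (- N * 2) * (1 / 2 - x) by rewrite mulr_gt0 ?expR_gt0//; lra.
  lra.
move=> lnN; rewrite /Psi -mulrN.
have : 0 <= (1 / 2 - 2 * x) * N * 2 by rewrite !mulr_ge0 //; lra.
have : (1 - 2 * x) * (N * 2) <= (1 - 2 * x) * - ln (x / (1 - x)).
  by rewrite ler_pM2l; lra.
lra.
Qed.

Lemma dPsi_lt {R : realType} {x y : R} : 0 < x -> x < y -> y < 1 -> dPsi y < dPsi x.
Proof.
move=> x0 xy y1; apply: neg_derive_gt xy _ _ => z hz.
  by apply: is_derive_dPsi; lra.
by rewrite oppr_lt0 invr_gt0 exprn_gt0// mulr_gt0 //; lra.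
Qed.

(** * Sign and minimum of [calA g] under (G1) and (G2) *)

Lemma G1_ge0 {R : realType} {g : R -> R} {x : R} : G1 g -> 0 <= x <= 1 -> 0 <= g x.
Proof.
move=> [_ gc g0 g1] x01; have := gc 1 0 x; rewrite g0 g1 !in_itv /= ler01 !lexx x01.
by move=> /(_ isT isT isT); rewrite !mulr0 mulr1 !addr0.
Qed.

Lemma C2_derive {R : realType} {g : R -> R} {x : R} : C2_on01 g -> 0 < x < 1 ->
  is_derive x 1 g (g^`()%classic x) /\
  is_derive x 1 (g^`()%classic) (g^`(2)%classic x).
Proof.
move=> g2 x01; have [|gd gdd _] := g2 x; first by rewrite in_itv.
split; first by rewrite derive1E; exact: derivableP.
by rewrite /= derive1E; exact: derivableP.
Qed.

Lemma nbhs_continuous_gt {R : realType} {f : R -> R} {x c : R} :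
  {for x, continuous f} -> c < f x ->
  exists2 d, 0 < d & forall y, `|x - y| < d -> c < f y.
Proof.
move=> fc cf; have fcf : 0 < f x - c by rewrite subr_gt0.
have /nbhs_ballP[d d0 H] : \forall y \near x, `|f x - f y| < f x - c.
  by move/cvgrPdist_lt: fc => /(_ _ fcf).
exists d => // y /H /=; rewrite ltr_norml; lra.
Qed.

(** Were the second derivative positive at [x], it would be so nearby by continuity; the chords on
    the two sides of [x] would then have increasing slopes, against midpoint concavity. *)
Lemma G1_derive2_le0 {R : realType} {g : R -> R} {x : R} : G1 g -> 0 < x < 1 ->
  g^`(2)%classic x <= 0.
Proof.
move=> [g2 gc _ _] x01; rewrite leNgt; apply/negP => gx.
have [|_ _ gcont] := g2 x; first by rewrite in_itv.
have [d d0 hd] := nbhs_continuous_gt gcont gx.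
pose e := Num.min (d / 2) (Num.min (x / 2) ((1 - x) / 2)).
have e0 : 0 < e by rewrite !lt_min; apply/and3P; split; lra.
have : e <= e by [].
rewrite {2}/e !le_min => /and3P[ed ex e1].
have gD (y : R) : x - e <= y <= x + e ->
    is_derive y 1 g (g^`()%classic y) /\
    is_derive y 1 (g^`()%classic) (g^`(2)%classic y).
  by move=> ?; apply: C2_derive => //; lra.
have [||c1 /andP[? ?] E1] := @mean_value _ g (g^`()%classic) (x - e) x; first lra.
  by move=> y ?; apply: (gD y _).1; lra.
have [||c2 /andP[? ?] E2] := @mean_value _ g (g^`()%classic) x (x + e); first lra.
  by move=> y ?; apply: (gD y _).1; lra.
have : g^`()%classic c1 < g^`()%classic c2.
  apply: (@pos_derive_lt _ _ (g^`(2)%classic)); first lra.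
    by move=> y ?; apply: (gD y _).2; lra.
  by move=> y ?; apply: hd; rewrite ltr_norml; lra.
have := gc (x - e) (x + e) (1 / 2); rewrite !in_itv /=.
have -> : 1 / 2 * (x - e) + (1 - 1 / 2) * (x + e) = x by lra.
have H1 : 0 <= x - e <= 1 by lra.
have H2 : 0 <= x + e <= 1 by lra.
have H3 : 0 <= (1 / 2 : R) <= 1 by lra.
move=> /(_ H1 H2 H3) gx2; rewrite -(ltr_pM2r e0).
lra.
Qed.

Lemma calA_continuous {R : realType} {g : R -> R} {x : R} : C2_on01 g -> 0 < x < 1 ->
  {for x, continuous (calA g)}.
Proof.
move=> g2 x01; have [|_ _ gc] := g2 x; first by rewrite in_itv.
have idc : (fun y : R => y) @ x --> x by exact: cvg_id.
have cc (c : R) : (fun=> c) @ x --> c by exact: cvg_cst.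
have ocx : (fun y : R => 1 - y) @ x --> 1 - x by exact: cvgB.
have i2 : (fun y : R => y ^+ 2) @ x --> x ^+ 2 by exact: cvgM.
have o2 : (fun y : R => (1 - y) ^+ 2) @ x --> (1 - x) ^+ 2 by exact: cvgM.
have c2 : (fun y : R => 2^-1 * y ^+ 2) @ x --> 2^-1 * x ^+ 2 by exact: cvgM.
have c3 : (fun y : R => 2^-1 * y ^+ 2 * (1 - y) ^+ 2) @ x --> 2^-1 * x ^+ 2 * (1 - x) ^+ 2.
  by exact: cvgM.
exact: cvgM.
Qed.

Lemma calA_le0 {R : realType} {g : R -> R} {x : R} : G1 g -> 0 < x < 1 ->
  calA g x <= 0.
Proof.
move=> hG1 x01; rewrite mulr_ge0_le0 ?(G1_derive2_le0 hG1 x01)//.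
by rewrite -mulrA -exprMn; apply: mulr_ge0 => //; exact: sqr_ge0.
Qed.

(** The monotonicity in (G2) leaves out [p0], so continuity supplies the comparison: a value at [y]
    below [calA g p0] would bound [calA g] from above between [y] and [p0], even arbitrarily close
    to [p0]. The midpoint of [x] and [p0] makes the inequality strict. *)
Lemma calA_gt_min {R : realType} {g : R -> R} {p0 x : R} : G1 g -> G2 g p0 ->
  0 < x < 1 -> x != p0 -> calA g p0 < calA g x.
Proof.
move=> [g2 _ _ _] [/[!in_itv] /= p01 adec ainc] x01.
have cont := calA_continuous g2 p01.
have ge y : 0 < y < 1 -> y != p0 -> calA g p0 <= calA g y.
  move=> y01 yp; rewrite leNgt; apply/negP => /(nbhs_continuous_gt cont)[d d0 hd].
  case: (ltgtP y p0) yp => // yp _.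
    pose z := Num.max (p0 - d / 2) ((y + p0) / 2).
    have : z <= z by [].
    rewrite {1}/z ge_max => /andP[z1 z2].
    have zp : z < p0 by rewrite gt_max; apply/andP; split; lra.
    have : calA g z < calA g y by apply: adec; rewrite ?in_itv /=; lra.
    by apply/negP; rewrite -leNgt; apply/ltW/hd; rewrite ltr_norml; lra.
  pose z := Num.min (p0 + d / 2) ((y + p0) / 2).
  have : z <= z by [].
  rewrite {2}/z le_min => /andP[z1 z2].
  have zp : p0 < z by rewrite lt_min; apply/andP; split; lra.
  have : calA g z < calA g y by apply: ainc; rewrite ?in_itv /=; lra.
  by apply/negP; rewrite -leNgt; apply/ltW/hd; rewrite ltr_norml; lra.
case: (ltgtP x p0) => // xp _.
  apply: (@le_lt_trans _ _ (calA g ((x + p0) / 2))).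
    by apply: ge; [lra|rewrite lt_eqF//; lra].
  by apply: adec; rewrite ?in_itv /=; lra.
apply: (@le_lt_trans _ _ (calA g ((x + p0) / 2))).
  by apply: ge; [lra|rewrite gt_eqF//; lra].
by apply: ainc; rewrite ?in_itv /=; lra.
Qed.

(** A point closer to the endpoint has a strictly larger value, which is still at most [0]; [p0] is
    covered by its being the strict minimum. *)
Lemma calA_lt0 {R : realType} {g : R -> R} {p0 x : R} : G1 g -> G2 g p0 ->
  0 < x < 1 -> calA g x < 0.
Proof.
move=> hG1 hG2 x01; case: (hG2) => /[!in_itv] /= p01 adec ainc.
case: (ltgtP x p0) => [xp|px|->].
- have : calA g (x / 2) <= 0 by apply: calA_le0 => //; lra.
  by apply: lt_le_trans; apply: adec; rewrite ?in_itv /=; lra.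
- have : calA g ((1 + x) / 2) <= 0 by apply: calA_le0 => //; lra.
  by apply: lt_le_trans; apply: ainc; rewrite ?in_itv /=; lra.
- have : calA g (p0 / 2) <= 0 by apply: calA_le0 => //; lra.
  apply: lt_le_trans; apply: (calA_gt_min hG1 hG2); first lra.
  by rewrite lt_eqF//; lra.
Qed.

(** The endpoints contribute [0]; in between, [- calA g] is positive and largest at [p0]. *)
Lemma betaE {R : realType} {g : R -> R} {p0 : R} : G1 g -> G2 g p0 ->
  beta g = - calA g p0.
Proof.
move=> hG1 hG2; case: (hG2) => /[!in_itv] /= p01 _ _.
have ap0 := calA_lt0 hG1 hG2 p01.
have ub : ubound [set `|calA g x| | x in `[0, 1] ] (- calA g p0).
  move=> _ [x /= /[!in_itv] /= /andP[x0 x1] <-].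
  have A0 : calA g 0 = 0 by rewrite /calA expr0n /= mulr0 !mul0r.
  have A1 : calA g 1 = 0 by rewrite /calA subrr expr0n /= mulr0 mul0r.
  have [->|x0'] := eqVneq x 0; first by rewrite A0 normr0 oppr_ge0 ltW.
  have [->|x1'] := eqVneq x 1; first by rewrite A1 normr0 oppr_ge0 ltW.
  have x01 : 0 < x < 1 by rewrite !lt_neqAle x0 x1 x1' eq_sym x0'.
  rewrite (ltr0_norm (calA_lt0 hG1 hG2 x01)) lerN2.
  by have [->//|xp] := eqVneq x p0; exact/ltW/(calA_gt_min hG1 hG2).
have mem : [set `|calA g x| | x in `[0, 1] ] (- calA g p0).
  by exists p0; rewrite ?ltr0_norm//= in_itv /=; lra.
apply/eqP; rewrite eq_le; apply/andP; split.
- by apply: ge_sup => //; exists (- calA g p0).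
- by apply: ub_le_sup => //; exists (- calA g p0).
Qed.

(** * Slope and shape of [H g K] *)

(** The parameter [e] stands for [K^-1]; [e = beta g] gives the limiting slope. *)
Definition dH {R : realType} (g : R -> R) (e x : R) : R :=
  g^`()%classic x - 2 * e * dPsi x.

Lemma is_derive_H {R : realType} {g : R -> R} {K x : R} : C2_on01 g -> 0 < x < 1 ->
  is_derive x 1 (H g K) (dH g K^-1 x).
Proof.
move=> g2 x01; have [gd _] := C2_derive g2 x01.
by apply: (is_derive_eq (is_deriveB gd (is_deriveZ (2 * K^-1) (is_derive_Psi x01)))).
Qed.

Lemma is_derive_dH {R : realType} {g : R -> R} {e x : R} : C2_on01 g -> 0 < x < 1 ->
  is_derive x 1 (dH g e) (2 * (x * (1 - x)) ^- 2 * (calA g x + e)).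
Proof.
move=> g2 x01; have [_ gd] := C2_derive g2 x01.
apply: (is_derive_eq (is_deriveB gd (is_deriveZ (2 * e) (is_derive_dPsi x01)))).
by rewrite /calA /GRing.scale /=; field; rewrite !gt_eqF //; lra.
Qed.

Lemma dH_lt {R : realType} {g : R -> R} {e x y : R} : C2_on01 g ->
  0 < x -> x < y -> y < 1 -> (forall z, x < z < y -> - e < calA g z) ->
  dH g e x < dH g e y.
Proof.
move=> g2 x0 xy y1 ae; apply: pos_derive_lt xy _ _ => z hz.
  by apply: is_derive_dH => //; lra.
have := ae z hz => aez; rewrite mulr_gt0//; last lra.
by rewrite mulr_gt0// invr_gt0 exprn_gt0// mulr_gt0//; lra.
Qed.

Lemma dH_gt {R : realType} {g : R -> R} {e x y : R} : C2_on01 g ->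
  0 < x -> x < y -> y < 1 -> (forall z, x < z < y -> calA g z < - e) ->
  dH g e y < dH g e x.
Proof.
move=> g2 x0 xy y1 ae; apply: neg_derive_gt xy _ _ => z hz.
  by apply: is_derive_dH => //; lra.
have := ae z hz => aez; rewrite pmulr_rlt0//; first lra.
by rewrite mulr_gt0// invr_gt0 exprn_gt0// mulr_gt0//; lra.
Qed.

Lemma H_ge_Psi {R : realType} {g : R -> R} {K x : R} : G1 g -> 0 < x < 1 ->
  2 * K^-1 * - Psi x <= H g K x.
Proof.
move=> hG1 /andP[x0 x1]; rewrite /H mulrN lerDr (G1_ge0 hG1)//.
by rewrite (ltW x0) (ltW x1).
Qed.

Lemma H_unbounded_left {R : realType} {g : R -> R} {K p : R} : G1 g -> 0 < K ->
  0 < p < 1 -> forall M, exists2 x, 0 < x < p & M < H g K x.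
Proof.
move=> hG1 K0 /andP[p0 p1] M; have K2 : 0 < 2 * K^-1 by rewrite mulr_gt0// invr_gt0.
have [x [xp x1] Mx] := Psi_unbounded_below (M / (2 * K^-1)) p0; exists x => //.
apply: lt_le_trans (H_ge_Psi hG1 _); last lra.
by rewrite mulrC -(ltr_pdivrMr _ _ K2).
Qed.

Lemma H_unbounded_right {R : realType} {g : R -> R} {K q : R} : G1 g -> 0 < K ->
  0 < q < 1 -> forall M, exists2 x, q < x < 1 & M < H g K x.
Proof.
move=> hG1 K0 /andP[q0 q1] M; have K2 : 0 < 2 * K^-1 by rewrite mulr_gt0// invr_gt0.
have q1' : 0 < 1 - q by rewrite subr_gt0.
have [x [xp x1] Mx] := Psi_unbounded_below (M / (2 * K^-1)) q1'; exists (1 - x); first lra.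
apply: lt_le_trans (H_ge_Psi hG1 _); last lra.
have x01 : 0 < x < 1 by rewrite x1; case/andP: xp => ->.
by rewrite (Psi1B x01) mulrC -(ltr_pdivrMr _ _ K2).
Qed.

(** The points with [c <= a x] keep [p] and [q] away from [0] and [1], and continuity puts a
    neighbourhood of [p0] into [E]. The strict inequalities come from monotonicity, by comparison
    with a point of [E] or with a midpoint outside it. *)
Lemma sublevel_endpoints {R : realType} {a : R -> R} {p0 c : R} :
  let E := [set x | x \in (`]0, 1[) /\ a x < c] in let p := inf E in let q := sup E in
  0 < p0 < 1 ->
  (forall x y : R, 0 < x -> x < y -> y < p0 -> a y < a x) ->
  (forall x y : R, p0 < x -> x < y -> y < 1 -> a x < a y) ->
  {for p0, continuous a} -> a p0 < c ->
  (exists2 x, 0 < x < p0 & c <= a x) -> (exists2 x, p0 < x < 1 & c <= a x) ->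
  [/\ 0 < p < p0, p0 < q < 1, (forall x, 0 < x < p -> c < a x),
    (forall x, p < x < q -> a x < c)
   & (forall x, q < x < 1 -> c < a x)].
Proof.
move=> E p q p01 adec ainc ac ap0 [l /andP[l0 lp] al] [r /andP[rp r1] ar].
have memE x : 0 < x < 1 -> a x < c -> E x by move=> x01 ?; split; rewrite ?in_itv.
have Ememb x : E x -> 0 < x < 1 /\ a x < c by case=> /[!in_itv].
have Ep0 : E p0 by apply: memE.
have lE : lbound E l.
  move=> y /Ememb[y01 ay]; rewrite leNgt; apply/negP => yl.
  by have := adec y l; lra.
have rE : ubound E r.
  move=> y /Ememb[y01 ay]; rewrite leNgt; apply/negP => yl.
  by have := ainc r y; lra.
have infE : has_inf E by split; [exists p0|exists l].
have supE : has_sup E by split; [exists p0|exists r].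
have lp' : l <= p by apply: lb_le_inf lE; exists p0.
have qr' : q <= r by apply: ge_sup rE; exists p0.
have [d d0 hd] : exists2 d, 0 < d & forall y, `|p0 - y| < d -> a y < c.
  have Nc : {for p0, continuous (fun x => - a x)} by exact: cvgN.
  have [|d d0 hd] := nbhs_continuous_gt (c := - c) Nc; first by rewrite ltrN2.
  by exists d => // y /hd; rewrite ltrN2.
have geE x : E x -> p <= x by apply: ge_inf; case: infE.
have leE x : E x -> x <= q by apply: ub_le_sup; case: supE.
have p_adh e : 0 < e -> exists2 x, E x & x < p + e by move=> /inf_adherent; apply.
have q_adh e : 0 < e -> exists2 x, E x & q - e < x by move=> /sup_adherent; apply.
clearbody p q E; clear infE supE.
have pp : p < p0.
  pose y := Num.max (p0 - d / 2) (p0 / 2).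
  have : y <= y by [].
  rewrite {1}/y ge_max => /andP[y1 y2].
  have yp : y < p0 by rewrite gt_max; apply/andP; split; lra.
  apply: (le_lt_trans _ yp); apply: geE.
  by apply: memE; [lra|apply: hd; rewrite ltr_norml; lra].
have pq : p0 < q.
  pose y := Num.min (p0 + d / 2) ((1 + p0) / 2).
  have : y <= y by [].
  rewrite {2}/y le_min => /andP[y1 y2].
  have yp : p0 < y by rewrite lt_min; apply/andP; split; lra.
  apply: (lt_le_trans yp); apply: leE.
  by apply: memE; [lra|apply: hd; rewrite ltr_norml; lra].
have notE x : 0 < x < 1 -> x < p \/ q < x -> c <= a x.
  move=> x01 xpq; rewrite leNgt; apply/negP => /(memE _ x01) Ex.
  by have := geE _ Ex; have := leE _ Ex; lra.
split; [lra|lra| | |] => x /andP[xl xr].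
- have : c <= a ((x + p) / 2) by apply: notE; lra.
  by move=> /le_lt_trans; apply; apply: adec; lra.
- have [|y /Ememb[y01 ay] yx] := p_adh (x - p); first by rewrite subr_gt0.
  have [|z /Ememb[z01 az] zx] := q_adh (q - x); first by rewrite subr_gt0.
  case: (ltgtP x p0) => [xp|px|->//].
    by have := adec y x; lra.
  by have := ainc x z; lra.
- have : c <= a ((x + q) / 2) by apply: notE; lra.
  by move=> /le_lt_trans; apply; apply: ainc; lra.
Qed.

Lemma below_set_endpoints {R : realType} {g : R -> R} {p0 K : R} :
  G1 g -> G2 g p0 -> 0 < K -> K^-1 < beta g ->
  let p := pi_lo g K in let q := pi_up g K in
  [/\ 0 < p < p0, p0 < q < 1, (forall x, 0 < x < p -> - K^-1 < calA g x),
    (forall x, p < x < q -> calA g x < - K^-1)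
   & (forall x, q < x < 1 -> - K^-1 < calA g x)].
Proof.
move=> hG1 hG2 K0; rewrite (betaE hG1 hG2) ltrNr => Kb.
case: (hG2) => /[!in_itv] /= p01 adec ainc; case: (hG1) => g2 _ _ _.
have HD (x : R) : 0 < x < 1 -> is_derive x 1 (H g K) (dH g K^-1 x).
  by move=> ?; exact: is_derive_H.
apply: (sublevel_endpoints p01 _ _ (calA_continuous g2 p01) Kb).
- by move=> x y x0 xy yp; apply: adec; rewrite ?in_itv /=; lra.
- by move=> x y x0 xy yp; apply: ainc; rewrite ?in_itv /=; lra.
(* If [calA g < - K^-1] held on all of []0, p0[], the slope [dH] would strictly decrease there,
   whereas the blow-up of [H] at [0] yields a slope no larger than the one at [p0]. *)
- have [x /andP[x0 xp] hx] :=
    slope_le_left (s := dH g K^-1 p0) p01 HD (H_unbounded_left hG1 K0 p01).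
  apply: contrapT => nex; move: hx; apply/negP; rewrite -ltNge.
  apply: (dH_gt g2 x0 xp); first by case/andP: p01.
  move=> z /andP[xz zp].
  rewrite ltNge; apply/negP => az; apply: nex; exists z; last exact: az.
  by rewrite (lt_trans x0 xz).
- have [x /andP[xp x1] hx] :=
    slope_ge_right (s := dH g K^-1 p0) p01 HD (H_unbounded_right hG1 K0 p01).
  apply: contrapT => nex; move: hx; apply/negP; rewrite -ltNge.
  apply: (dH_gt g2 _ xp x1); first by case/andP: p01.
  move=> z /andP[pz zx].
  rewrite ltNge; apply/negP => az; apply: nex; exists z; last exact: az.
  by rewrite pz (lt_trans zx x1).
Qed.

Lemma H_convex_concave_convex {R : realType} {g : R -> R} {p0 K : R} :
  G1 g -> G2 g p0 -> 0 < K -> K^-1 < beta g ->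
  convex_concave_convex (H g K) (dH g K^-1) (pi_lo g K) (pi_up g K).
Proof.
move=> hG1 hG2 K0 Kb; case: (hG1) => g2 _ _ _.
have := below_set_endpoints hG1 hG2 K0 Kb.
move: (pi_lo g K) (pi_up g K) => p q /= [pp pq al am ar].
split=> [x x01|x y ? ? ?|x y ? ? ?|x y ? ? ?].
- exact: is_derive_H.
- by apply: (dH_lt g2); [lra|lra|lra|move=> z hz; apply: al; lra].
- by apply: (dH_gt g2); [lra|lra|lra|move=> z hz; apply: am; lra].
- by apply: (dH_lt g2); [lra|lra|lra|move=> z hz; apply: ar; lra].
Qed.

(** * The tangency pair: existence and dependence on [K] *)

(** [xget] returns an element of [tangency_pair g K] once [bitangent_exists] provides one. The
    formal derivative turns into the explicit [dH] because both points lie in []0, 1[]. *)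
Lemma AB_star_bitangent {R : realType} {g : R -> R} {p0 K : R} :
  G1 g -> G2 g p0 -> 0 < K -> K^-1 < beta g ->
  [/\ 0 < A_star g K <= pi_lo g K, pi_up g K <= B_star g K < 1
    & bitangent (H g K) (dH g K^-1) (A_star g K) (B_star g K)].
Proof.
move=> hG1 hG2 K0 Kb; case: (hG1) => g2 _ _ _.
have dHE x : 0 < x < 1 -> (H g K)^`()%classic x = dH g K^-1 x.
  by move=> x01; rewrite derive1E; apply: derive_val; exact: is_derive_H.
have [pp pq _ _ _] := below_set_endpoints hG1 hG2 K0 Kb.
have cH := H_convex_concave_convex hG1 hG2 K0 Kb.
have : tangency_pair g K (AB_star g K).
  apply: xgetPex.
  have [||||||A [B [hA hB [HE hE]]]] := bitangent_exists _ _ _ cH.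
  - lra.
  - lra.
  - lra.
  - by move=> x x01; exact: is_derive_continuous (is_derive_dH g2 x01).
  - by apply: H_unbounded_left => //; lra.
  - by apply: H_unbounded_right => //; lra.
  exists (A, B); split; [|lra|lra| |].
  - by rewrite !in_itv /=; apply/andP; split; lra.
  - by rewrite dHE //; lra.
  - by rewrite !dHE //; lra.
rewrite /A_star /B_star; case: (AB_star g K) => A B [] /=.
rewrite !in_itv /= => /andP[A01 B01] Ap qB.
rewrite !dHE// => HE hE; split; [lra|lra|by []].
Qed.

Lemma beta_gt0 {R : realType} {g : R -> R} {p0 : R} : G1 g -> G2 g p0 -> 0 < beta g.
Proof.
move=> hG1 hG2; rewrite (betaE hG1 hG2) oppr_gt0 (calA_lt0 hG1 hG2)//.
by case: hG2; rewrite in_itv.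
Qed.

Lemma invf_gt_lt {R : realType} {b K : R} : 0 < b -> b^-1 < K -> 0 < K /\ K^-1 < b.
Proof.
move=> b0 bK; have K0 : 0 < K by rewrite (lt_trans _ bK)// invr_gt0.
by split=> //; rewrite -[ltRHS]invrK ltf_pV2// posrE invr_gt0.
Qed.

Lemma AB_star_itv {R : realType} {g : R -> R} {p0 K : R} :
  G1 g -> G2 g p0 -> (beta g)^-1 < K ->
  0 < A_star g K < p0 /\ p0 < B_star g K < 1.
Proof.
move=> hG1 hG2 /(invf_gt_lt (beta_gt0 hG1 hG2))[K0 Kb].
have [hA hB _] := AB_star_bitangent hG1 hG2 K0 Kb.
have [hp hq _ _ _] := below_set_endpoints hG1 hG2 K0 Kb.
lra.
Qed.

(** This is [bitangent_lt] from [H g L] to [H g K], with [- Psi] as the convex function and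
    [d = 2 * (K^-1 - L^-1)]; [p0] is the point [c] common to both concave parts. *)
Lemma AB_star_lt {R : realType} {g : R -> R} {p0 K L : R} :
  G1 g -> G2 g p0 -> (beta g)^-1 < K -> K < L ->
  A_star g L < A_star g K /\ B_star g K < B_star g L.
Proof.
move=> hG1 hG2 bK KL; have b0 := beta_gt0 hG1 hG2.
have [K0 Kb] := invf_gt_lt b0 bK.
have [L0 Lb] := invf_gt_lt b0 (lt_trans bK KL).
have LK : L^-1 < K^-1 by rewrite ltf_pV2.
have [hAK hBK bitK] := AB_star_bitangent hG1 hG2 K0 Kb.
have [hAL hBL bitL] := AB_star_bitangent hG1 hG2 L0 Lb.
have [hpK hqK _ _ _] := below_set_endpoints hG1 hG2 K0 Kb.
have [hpL hqL _ _ _] := below_set_endpoints hG1 hG2 L0 Lb.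
have cL := H_convex_concave_convex hG1 hG2 L0 Lb.
have cK := H_convex_concave_convex hG1 hG2 K0 Kb.
have d0 : 0 < 2 * (K^-1 - L^-1) by rewrite mulr_gt0// subr_gt0.
have HK x : H g K x = H g L x + 2 * (K^-1 - L^-1) * - Psi x by rewrite /H; ring.
have dHK x : dH g K^-1 x = dH g L^-1 x + 2 * (K^-1 - L^-1) * - dPsi x.
  by rewrite /dH; ring.
have dN (x : R) : 0 < x < 1 -> is_derive x 1 (fun x => - Psi x) (- dPsi x).
  by move=> /is_derive_Psi; exact: is_deriveN.
have dN_lt (x y : R) : 0 < x -> x < y -> y < 1 -> - dPsi x < - dPsi y.
  by move=> x0 xy y1; rewrite ltrN2 dPsi_lt.
exact: (bitangent_lt HK dHK d0 dN dN_lt hpL hqL cL hpK hqK cK hAL hBL bitL hAK hBK bitK).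
Qed.

(** * Limits as [K] tends to infinity and to [(beta g)^-1] *)

Lemma AB_star_le_of_calA_lt {R : realType} {g : R -> R} {p0 K x : R} :
  G1 g -> G2 g p0 -> (beta g)^-1 < K -> 0 < x < 1 -> calA g x < - K^-1 ->
  A_star g K <= x <= B_star g K.
Proof.
move=> hG1 hG2 /(invf_gt_lt (beta_gt0 hG1 hG2))[K0 Kb] x01 ax.
have [/andP[_ hA] /andP[hB _] _] := AB_star_bitangent hG1 hG2 K0 Kb.
have Ex : below_set g K x by split; rewrite ?in_itv.
have bnd y : below_set g K y -> 0 <= y <= 1.
  by case=> /[!in_itv] /= /andP[/ltW -> /ltW ->].
have lE : has_lbound (below_set g K) by exists 0 => y /bnd /andP[].
have uE : has_ubound (below_set g K) by exists 1 => y /bnd /andP[].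
by rewrite (le_trans hA (ge_inf lE Ex)) (le_trans (ub_le_sup uE Ex) hB).
Qed.

Lemma AB_star_le_near {R : realType} {g : R -> R} {p0 x : R} :
  G1 g -> G2 g p0 -> 0 < x < 1 ->
  \forall K \near +oo, A_star g K <= x <= B_star g K.
Proof.
move=> hG1 hG2 x01; near=> K.
have bK : (beta g)^-1 < K by near: K; apply: nbhs_pinfty_gt; exact: num_real.
(* Beyond this threshold [x] belongs to [below_set g K]. *)
have aK : (- calA g x)^-1 < K by near: K; apply: nbhs_pinfty_gt; exact: num_real.
apply: (AB_star_le_of_calA_lt hG1 hG2 bK x01).
have ax : 0 < - calA g x by rewrite oppr_gt0 (calA_lt0 hG1 hG2).
by rewrite ltrNr; case: (invf_gt_lt ax aK).
Unshelve. all: by end_near. Qed.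

(** Up to a positive factor the derivative at [x] is [calA g x - calA g p0], which vanishes only at
    [p0]; hence the cut at [p0]. *)
Lemma dH_beta_lt {R : realType} {g : R -> R} {p0 x y : R} : G1 g -> G2 g p0 ->
  0 < x -> x < y -> y < 1 -> dH g (beta g) x < dH g (beta g) y.
Proof.
move=> hG1 hG2 x0 xy y1; case: (hG1) => g2 _ _ _.
have pos u v : 0 < u -> u < v -> v < 1 -> v <= p0 \/ p0 <= u ->
    dH g (beta g) u < dH g (beta g) v.
  move=> u0 uv v1 uvp; apply: (dH_lt g2 u0 uv v1) => z /andP[uz zv].
  rewrite (betaE hG1 hG2) opprK; apply: (calA_gt_min hG1 hG2).
    by rewrite (lt_trans u0 uz) (lt_trans zv v1).
  case: uvp => [vp|pu]; first by rewrite lt_eqF// (lt_le_trans zv vp).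
  by rewrite gt_eqF// (le_lt_trans pu uz).
have [yp|py] := leP y p0; first by apply: pos => //; left.
have [px|xp] := leP p0 x; first by apply: pos => //; right.
apply: (@lt_trans _ _ (dH g (beta g) p0)); apply: pos => //.
- exact: lt_trans py y1.
- by left.
- exact: lt_trans x0 xp.
- by right.
Qed.

(* The function [dH g (beta g)] is strictly increasing, whereas equal slopes at
   [A_star g K] and [B_star g K] bound its increment between these points by a
   multiple of [beta g - K^-1]. *)
Lemma AB_star_narrow_near {R : realType} {g : R -> R} {p0 u v : R} :
  G1 g -> G2 g p0 -> 0 < u -> u < v -> v < 1 ->
  \forall K \near ((beta g)^-1)^'+, u < A_star g K \/ B_star g K < v.
Proof.
move=> hG1 hG2 u0 uv v1; have b0 := beta_gt0 hG1 hG2.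
have /andP[p00 p1] : 0 < p0 < 1 by case: hG2; rewrite in_itv.
(* A reference parameter: for [K < L], monotonicity traps both points between [A_star g L] and
   [B_star g L], so [C] bounds the drop of [dPsi] between them for all such [K]. *)
pose L := (beta g)^-1 + 1.
have bL : (beta g)^-1 < L by rewrite ltrDl.
have [/andP[AL0 _] /andP[_ BL1]] := AB_star_itv hG1 hG2 bL.
have ALBL : A_star g L < B_star g L.
  by have [/andP[_ h] /andP[k _]] := AB_star_itv hG1 hG2 bL; exact: lt_trans h k.
pose C := dPsi (A_star g L) - dPsi (B_star g L).
have C0 : 0 < C by rewrite subr_gt0 dPsi_lt.
pose m := dH g (beta g) v - dH g (beta g) u.
have m0 : 0 < m by rewrite subr_gt0 (dH_beta_lt hG1 hG2).
have Vcvg : K^-1 @[K --> ((beta g)^-1)^'+] --> beta g.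
  rewrite -[X in _ --> X]invrK; apply: cvgV; first by rewrite gt_eqF// invr_gt0.
  by apply: cvg_at_right_filter; exact: cvg_id.
have e0 : 0 < m / (2 * C) by rewrite divr_gt0// mulr_gt0.
near=> K.
have bK : (beta g)^-1 < K by near: K; exact: nbhs_right_gt.
have KL : K < L by near: K; exact: nbhs_right_lt.
have Ke : `|beta g - K^-1| < m / (2 * C).
  by near: K; move/cvgrPdist_lt: Vcvg => /(_ _ e0).
have [AL BL] := AB_star_lt hG1 hG2 bK KL.
have [/andP[A0 Ap] /andP[pB B1]] := AB_star_itv hG1 hG2 bK.
have [K0 Kb] := invf_gt_lt b0 bK.
have [_ _ [_ hAB]] := AB_star_bitangent hG1 hG2 K0 Kb.
move: Ke; rewrite gtr0_norm ?subr_gt0// ltr_pdivlMr ?mulr_gt0// => Ke.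
have [uA|Au] := ltP u (A_star g K); first by left.
right; rewrite ltNge; apply/negP => vB.
have hA : dH g (beta g) (A_star g K) <= dH g (beta g) u.
  move: Au; rewrite le_eqVlt => /predU1P[->//|Au].
  by apply/ltW/(dH_beta_lt hG1 hG2) => //; exact: lt_trans uv v1.
have hB : dH g (beta g) v <= dH g (beta g) (B_star g K).
  move: vB; rewrite le_eqVlt => /predU1P[->//|vB].
  by apply/ltW/(dH_beta_lt hG1 hG2) => //; exact: lt_trans u0 uv.
have PA : dPsi (A_star g K) < dPsi (A_star g L).
  exact: dPsi_lt AL0 AL (lt_trans Ap p1).
have PB : dPsi (B_star g L) < dPsi (B_star g K).
  exact: dPsi_lt (lt_trans p00 pB) BL BL1.
have bK0 : 0 < beta g - K^-1 by rewrite subr_gt0.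
have bKC : (beta g - K^-1) * (dPsi (A_star g K) - dPsi (B_star g K)) <=
    (beta g - K^-1) * C.
  by rewrite (ler_pM2l bK0); apply: lerB; exact: ltW.
(* By [hAB], the increment of [dH g (beta g)] from [A_star g K] to [B_star g K] is
   [2 * (beta g - K^-1)] times the drop of [dPsi]. It is at least [m] by [hA] and [hB], yet below
   [m] by [bKC] and [Ke]. *)
move: hA hB hAB Ke bKC; rewrite /m /dH; clear; clearbody C.
move: (dPsi (A_star g K)) (dPsi (B_star g K)) (K^-1) (beta g) C (g^`()%classic _)
  (g^`()%classic _) (g^`()%classic _) (g^`()%classic _) (dPsi _) (dPsi _).
move=> *; lra.
Unshelve. all: by end_near. Qed.

Theorem proposition4p2 (R : realType) (g : R -> R) (p0 : R)
    (hG1 : G1 g) (hG2 : G2 g p0) :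
  [/\ {in `](beta g)^-1, +oo[ &, {homo A_star g : K L /~ K < L}}
        /\ {in `](beta g)^-1, +oo[ &, {homo B_star g : K L / K < L}},
      A_star g K @[K --> +oo] --> (0 : R) /\ B_star g K @[K --> +oo] --> (1 : R)
    & A_star g K @[K --> ((beta g)^-1)^'+] --> p0
        /\ B_star g K @[K --> ((beta g)^-1)^'+] --> p0].
Proof.
have p01 : 0 < p0 < 1 by case: hG2; rewrite in_itv.
have [p00 p1] := andP p01.
split; split.
- move=> K L; rewrite !in_itv /= !andbT => _ bL LK.
  by case: (AB_star_lt hG1 hG2 bL LK).
- move=> K L; rewrite !in_itv /= !andbT => bK _ KL.
  by case: (AB_star_lt hG1 hG2 bK KL).
(* The cap [p0] keeps [x] in []0, 1[] for large [e]. *)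
- apply/cvgrPdist_lt => e e0; pose x := Num.min (e / 2) p0.
  have x01 : 0 < x < 1 by rewrite lt_min gt_min p1 orbT p00 divr_gt0.
  have x_near := AB_star_le_near hG1 hG2 x01.
  near=> K.
  have bK : (beta g)^-1 < K by near: K; apply: nbhs_pinfty_gt; exact: num_real.
  have [/andP[A0 _] _] := AB_star_itv hG1 hG2 bK.
  rewrite sub0r normrN gtr0_norm//.
  have /andP[Ax _] : A_star g K <= x <= B_star g K by near: K; exact: x_near.
  by apply: (le_lt_trans Ax); rewrite gt_min ltr_pdivrMr// ltr_pMr// ltr1n.
- apply/cvgrPdist_lt => e e0; pose x := Num.max (1 - e / 2) p0.
  have x01 : 0 < x < 1.
    by rewrite lt_max gt_max p1 p00 orbT andbT ltrBlDr ltrDl divr_gt0.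
  have x_near := AB_star_le_near hG1 hG2 x01.
  near=> K.
  have bK : (beta g)^-1 < K by near: K; apply: nbhs_pinfty_gt; exact: num_real.
  have [_ /andP[_ B1]] := AB_star_itv hG1 hG2 bK.
  rewrite gtr0_norm ?subr_gt0//.
  have /andP[_] : A_star g K <= x <= B_star g K by near: K; exact: x_near.
  by rewrite ge_max => /andP[xB _]; lra.
- apply/cvgrPdist_lt => e e0; pose u := Num.max (p0 - e / 2) (p0 / 2).
  have u0 : 0 < u by rewrite lt_max divr_gt0// orbT.
  have up : u < p0 by rewrite gt_max; apply/andP; split; lra.
  (* With [v = p0] only the first alternative can hold, because [p0 < B_star g K]; the last limit
     uses [u = p0] in the same way. *)
  have u_near := AB_star_narrow_near hG1 hG2 u0 up p1.
  near=> K.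
  have bK : (beta g)^-1 < K by near: K; exact: nbhs_right_gt.
  have [/andP[_ Ap] /andP[pB _]] := AB_star_itv hG1 hG2 bK.
  rewrite gtr0_norm ?subr_gt0//.
  have : u < A_star g K \/ B_star g K < p0 by near: K; exact: u_near.
  by case; [rewrite gt_max => /andP[uA _]; lra|rewrite ltNge (ltW pB)].
- apply/cvgrPdist_lt => e e0; pose v := Num.min (p0 + e / 2) ((1 + p0) / 2).
  have pv : p0 < v by rewrite lt_min; apply/andP; split; lra.
  have v1 : v < 1 by rewrite gt_min; apply/orP; right; lra.
  have v_near := AB_star_narrow_near hG1 hG2 p00 pv v1.
  near=> K.
  have bK : (beta g)^-1 < K by near: K; exact: nbhs_right_gt.
  have [/andP[_ Ap] /andP[pB _]] := AB_star_itv hG1 hG2 bK.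
  rewrite distrC gtr0_norm ?subr_gt0//.
  have : p0 < A_star g K \/ B_star g K < v by near: K; exact: v_near.
  by case; [rewrite ltNge (ltW Ap)|rewrite lt_min => /andP[uA _]; lra].
Unshelve. all: by end_near. Qed.
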